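(* Let $N\ge1$. Suppose $A(t)$ is a continuous $d\times d$ (complex) matrix-valued function of $t\in I=[-1,1]$, $\mathbf{u}\in\mathbf{C}(I)$, and $\mathbf{y}_0\in\mathbb{C}^d$. Suppose $$\left|\Phi_A(t)\Phi_A(s)^{-1}\right|\le C_A\quad\text{for all }-1\le s\le t\le1.$$ Suppose $\mathbf{y}\in\mathbf{C}(I)$ satisfies $\dot{\mathbf{y}}(t)=A(t)\mathbf{y}(t)+\mathbf{u}(t)$, $\mathbf{y}(-1)=\mathbf{y}_0$. Let $\mathbf{p}$ be a $\mathbb{C}^d$-valued polynomial of degree at most $N$ satisfying $$\dot{\mathbf{p}}(t_j)=A(t_j)\mathbf{p}(t_j)+\mathbf{u}(t_j),\quad0\le j\le N-1,\qquad\mathbf{p}(-1)=\mathbf{y}_0,$$ and let $R_{\mathbf{p}}=\dot{\mathbf{p}}(-1)-A(-1)\mathbf{y}_0-\mathbf{u}(-1)$. Then $$\|\mathbf{y}-\mathbf{p}\|_\infty\le2C_A\Big[\|A\mathbf{p}-\mathbf{I}_N(A\mathbf{p})\|_\infty+\|\mathbf{u}-\mathbf{I}_N(\mathbf{u})\|_\infty+|R_{\mathbf{p}}|\Big]$$ and $$\|\dot{\mathbf{y}}-\dot{\mathbf{p}}\|_\infty\le\left(2\|A\|_\infty C_A+1\right)\Big[\|A\mathbf{p}-\mathbf{I}_N(A\mathbf{p})\|_\infty+\|\mathbf{u}-\mathbf{I}_N(\mathbf{u})\|_\infty+|R_{\mathbf{p}}|\Big].$$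
   Context: $\mathbf{C}(I)$ is the space of continuous functions $I\to\mathbb{C}^d$. $|\cdot|$ is the Euclidean norm on $\mathbb{C}^d$ and the induced norm on $d\times d$ matrices; $\|\mathbf{f}\|_\infty=\max_{t\in I}|\mathbf{f}(t)|$ and $\|A\|_\infty=\max_{t\in I}|A(t)|$. $\Phi_A$ is the fundamental solution: $\dot\Phi_A(t)=A(t)\Phi_A(t)$, $\Phi_A(-1)=I_d$. The Chebyshev collocation points are $t_j=\cos(\pi j/N)$, $j=0,\dots,N$. For $\mathbf{f}\in\mathbf{C}(I)$, $\mathbf{I}_N(\mathbf{f})$ is the unique $\mathbb{C}^d$-valued polynomial of degree at most $N$ with $\mathbf{I}_N(\mathbf{f})(t_j)=\mathbf{f}(t_j)$ for $j=0,\dots,N$. *)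

(* Defs.v *)
From HB Require Import structures.
From mathcomp Require Import all_boot all_order all_algebra.
From mathcomp Require Import complex.
From mathcomp Require Import all_classical all_reals all_analysis.

Set Implicit Arguments.
Unset Strict Implicit.
Unset Printing Implicit Defensive.

Import Order.TTheory GRing.Theory Num.Theory.
Import numFieldNormedType.Exports.

Local Open Scope classical_set_scope.
Local Open Scope ring_scope.
Local Open Scope complex_scope.

(* The usual topology of R[i] (given by the modulus); without this instance
   matrices over R[i] carry no topology. *)
HB.instance Definition _ (R : rcfType) := NormedModule.copy R[i] R[i]^o.

(* Functions on the interval are represented by functions on R; only their
   values on I11 are ever used. *)
Definition I11 (R : realType) : set R := `[-1, 1].
Arguments I11 : clear implicits.

Definition cont_on (R : realType) m n (f : R -> 'M[R[i]]_(m, n)) : Prop :=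
  {within I11 R, continuous f}.

Definition euclid_norm (R : realType) d (v : 'cV[R[i]]_d) : R :=
  Num.sqrt (\sum_(k < d) ComplexField.Normc.normc (v k 0) ^+ 2).

Definition op_norm (R : realType) d (M : 'M[R[i]]_d) : R :=
  sup [set euclid_norm (M *m v) | v in [set v | euclid_norm v <= 1]].

(* The sup is a max whenever f is continuous on the interval; on unbounded sets
   sup has the junk value 0. *)
Definition vnorm_oo (R : realType) d (f : R -> 'cV[R[i]]_d) : R :=
  sup [set euclid_norm (f t) | t in I11 R].

Definition mnorm_oo (R : realType) d (A : R -> 'M[R[i]]_d) : R :=
  sup [set op_norm (A t) | t in I11 R].

(* f has derivative l at t, relative to the interval: the two-sided derivative
   at interior points, the one-sided one at -1 and 1. *)
Definition is_derive_on (R : realType) m n (f : R -> 'M[R[i]]_(m, n)) (t : R)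
    (l : 'M[R[i]]_(m, n)) : Prop :=
  ((s - t)^-1)%:C *: (f s - f t) @[s --> within (I11 R) (t^')] --> l.

Definition is_fundamental_solution (R : realType) d (A Phi : R -> 'M[R[i]]_d) :
    Prop :=
  (forall t, I11 R t -> is_derive_on Phi t (A t *m Phi t)) /\
  Phi (-1) = 1%:M.

(* C^d-valued polynomials are column vectors of complex polynomials, evaluated
   at real points. *)
Definition vpoly_degree_le (R : realType) d (N : nat) (p : 'cV[{poly R[i]}]_d) :
    Prop :=
  forall k, (size (p k 0%R) <= N.+1)%N.

Definition vpoly_eval (R : realType) d (p : 'cV[{poly R[i]}]_d) (t : R) :
    'cV[R[i]]_d :=
  map_mx (fun q : {poly R[i]} => q.[t%:C]) p.

Definition vpoly_deriv (R : realType) d (p : 'cV[{poly R[i]}]_d) :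
    'cV[{poly R[i]}]_d :=
  map_mx (fun q : {poly R[i]} => q^`()) p.

Definition cheb_node (R : realType) (N j : nat) : R :=
  cos (pi * j%:R / N%:R).

Definition is_cheb_interp (R : realType) d (N : nat) (f : R -> 'cV[R[i]]_d)
    (q : 'cV[{poly R[i]}]_d) : Prop :=
  vpoly_degree_le N q /\
  forall j, (j <= N)%N -> vpoly_eval q (cheb_node R N j) = f (cheb_node R N j).

(* The polynomial characterised by is_cheb_interp, which exists and is unique
   for 0 < N by cheb_interp_unique_exists below. *)
Definition cheb_interp (R : realType) d (N : nat) (f : R -> 'cV[R[i]]_d) :
    'cV[{poly R[i]}]_d :=
  xget 0 [set q | is_cheb_interp N f q].

Lemma cheb_node_inj (R : realType) (N j k : nat) :
  (0 < N)%N -> (j <= N)%N -> (k <= N)%N ->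
  cheb_node R N j = cheb_node R N k -> j = k.
Proof.
move=> N0 jN kN.
have NR : 0 < N%:R :> R by rewrite ltr0n.
have piR := pi_gt0 R.
have H l : (l <= N)%N -> pi * l%:R / N%:R \in `[0 : R, pi].
  move=> lN; rewrite in_itv /=; apply/andP; split.
    by rewrite divr_ge0 ?mulr_ge0 ?ler0n // ltW.
  by rewrite ler_pdivrMr // ler_pM2l // ler_nat.
move=> /(cos_inj (H j jN) (H k kN)).
move=> /(mulIf (invr_neq0 (lt0r_neq0 NR))) /(mulfI (lt0r_neq0 piR)) /eqP.
by rewrite eqr_nat => /eqP.
Qed.

Lemma poly_interp_exists (F : fieldType) (x g : nat -> F) (N : nat) :
  (forall j k, (j <= N)%N -> (k <= N)%N -> x j = x k -> j = k) ->
  exists2 q : {poly F}, (size q <= N.+1)%N &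
    forall j, (j <= N)%N -> q.[x j] = g j.
Proof.
elim: N => [|N IH] xI.
  exists (g 0%N)%:P => [|j]; first exact: size_polyC_leq1.
  by rewrite leqn0 => /eqP ->; rewrite hornerC.
have [|q sq qg] := IH.
  by move=> j k jN kN; apply: xI; apply: leqW.
pose w := \prod_(z <- [seq x j | j <- iota 0 N.+1]) ('X - z%:P).
have w0 j : (j <= N)%N -> w.[x j] = 0.
  move=> jN; apply/eqP; rewrite -/(root w (x j)) root_prod_XsubC.
  by apply: map_f; rewrite mem_iota.
have wN : w.[x N.+1] != 0.
  rewrite -/(root w (x N.+1)) root_prod_XsubC; apply/negP => /mapP[j].
  rewrite mem_iota /= add0n => jN /(xI N.+1 j (leqnn _) (ltnW jN)) jE.
  by move: jN; rewrite -jE ltnn.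
exists (q + ((g N.+1 - q.[x N.+1]) / w.[x N.+1]) *: w).
  rewrite (leq_trans (size_polyD _ _)) // geq_max (leqW sq) /=.
  rewrite (leq_trans (size_scale_leq _ _)) //.
  by rewrite size_prod_XsubC size_map size_iota.
move=> j; rewrite leq_eqVlt => /orP[/eqP ->|jN].
  by rewrite hornerD hornerZ divfK // addrC subrK.
by rewrite hornerD hornerZ (w0 j) // mulr0 addr0 qg.
Qed.

Lemma cheb_interp_unique_exists (R : realType) d (N : nat)
    (f : R -> 'cV[R[i]]_d) : (0 < N)%N ->
  is_cheb_interp N f (cheb_interp N f) /\
  forall q, is_cheb_interp N f q -> q = cheb_interp N f.
Proof.
move=> N0.
pose x j : R[i] := (cheb_node R N j)%:C.
have xI j k : (j <= N)%N -> (k <= N)%N -> x j = x k -> j = k.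
  by move=> jN kN /complexI; apply: cheb_node_inj.
have ex : is_cheb_interp N f (cheb_interp N f).
  rewrite /cheb_interp; apply: (@xgetPex _ 0 [set q | is_cheb_interp N f q]).
  have H k : exists q : {poly R[i]}, (size q <= N.+1)%N /\
      forall j, (j <= N)%N -> q.[x j] = f (cheb_node R N j) k 0.
    have [q ? ?] := poly_interp_exists (fun j => f (cheb_node R N j) k 0) xI.
    by exists q.
  have [h hP] := boolp.choice H.
  exists (\col_k h k); split=> [k|j jN]; first by rewrite mxE; case: (hP k).
  by apply/matrixP => k l; rewrite !mxE ord1 (hP k).2.
split=> // q [sq qE]; case: ex => [sc cE].
apply/matrixP => k l; rewrite ord1; apply/eqP; rewrite -subr_eq0; apply/eqP.
apply: (@roots_geq_poly_eq0 _ _ [seq x j | j <- iota 0 N.+1]).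
- apply/allP => z /mapP[j]; rewrite mem_iota /= add0n ltnS => jN ->.
  rewrite rootE hornerD hornerN subr_eq0.
  have := etrans (qE j jN) (esym (cE j jN)).
  by move/matrixP/(_ k 0); rewrite !mxE => ->.
- rewrite map_inj_in_uniq ?iota_uniq // => a b.
  by rewrite !mem_iota /= !add0n !ltnS; apply: xI.
- rewrite size_map size_iota (leq_trans (size_polyD _ _)) //.
  by rewrite geq_max size_polyN sq sc.
Qed.

(* Main.v *)
Require Import Defs.
From mathcomp Require Import all_boot all_order all_algebra.
From mathcomp Require Import complex.
From mathcomp Require Import all_classical all_reals all_analysis.
From mathcomp Require Import ring lra.
Import Order.TTheory GRing.Theory Num.Theory.
Import numFieldNormedType.Exports.
Local Open Scope classical_set_scope.
Local Open Scope ring_scope.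
Local Open Scope complex_scope.

(** Let [r = p' - A p - u] be the defect of the collocation polynomial and
    [e = y - p] its error, so that [e' = A e - r] and [e (-1) = 0].  Both
    estimates follow from the pointwise bound [|r| <= E], where [E] is the
    bracket of the two interpolation errors and the boundary residual.

    The bound on [r].  The polynomial [p' - I_N(Ap) - I_N(u)] has degree at most
    [N], and it takes the values of [r] at the nodes: zero at the nodes
    [t_0, ..., t_(N-1)] and [R_p] at [t_N = -1].  It is therefore [l R_p], with
    [l] the cardinal polynomial of the node [-1], so that
    [r = l R_p - (Ap - I_N(Ap)) - (u - I_N(u))].  Up to a scalar, [l] is
    [(X - 1) U_(N-1)], where [U] denotes the Chebyshev polynomials of the second
    kind; on the interval [|t - 1| <= 2] and [|U_(N-1)| <= N], with equality in
    both at [-1], whence [|l| <= 1] ([cheb_boundary_cardinal],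
    [interp_defect_cardinal], [defect_bound]).

    From [r] to [e].  For fixed [t], the function
    [w s = Phi t (Phi s)^-1 e s] runs from [0] at [s = -1] to [e t] at [s = t],
    and its derivative is [- Phi t (Phi s)^-1 r s], of norm at most [C_A E].
    Hence [|e t| <= C_A E (t + 1) <= 2 C_A E] ([inhomogeneous_bound]).  The
    matrices [Phi s] are invertible because a solution [Phi v] of the
    homogeneous equation that vanishes somewhere vanishes at [-1] as well
    ([gronwall_zero], [fundamental_solution_unit]).  The bound on [e'] is then
    read off from [e' = A e - r].

    Derivatives relative to the interval are used as first-order expansions,
    [|f s - f t - (s - t) l| <= eps |s - t|] for [s] near [t].  Such local
    estimates become global through a real induction on intervals
    ([interval_induction]), which replaces both integration and the mean value
    theorem, and spares the differentiation of [Phi^-1]. *)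

Set Implicit Arguments.
Unset Strict Implicit.
Local Notation normc := ComplexField.Normc.normc.

(** * Moduli of complex numbers and the Minkowski inequality *)

Section Norms.
Variable R : realType.
Implicit Types z w : R[i].

Lemma normcD z w : normc (z + w) <= normc z + normc w.
Proof. exact: le_normcD. Qed.

Lemma normc_ge0 z : 0 <= normc z.
Proof. by case: z => a b; rewrite /= sqrtr_ge0. Qed.

Lemma normcN z : normc (- z) = normc z.
Proof. exact: complex.normcN. Qed.

Lemma normc_real (x : R) : normc x%:C = `|x|.
Proof. by rewrite /= expr0n /= addr0 sqrtr_sqr. Qed.

Lemma normc_sum I (r : seq I) (P : pred I) (F : I -> R[i]) :
  normc (\sum_(i <- r | P i) F i) <= \sum_(i <- r | P i) normc (F i).
Proof.
elim/big_rec2: _ => [|i y z _ le_zy]; first by rewrite ComplexField.Normc.normc0.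
by apply: le_trans (normcD _ _) _; rewrite lerD2l.
Qed.

Lemma minkowski_sum (I : finType) (a b : I -> R) :
  Num.sqrt (\sum_i (a i + b i) ^+ 2) <=
  Num.sqrt (\sum_i a i ^+ 2) + Num.sqrt (\sum_i b i ^+ 2).
Proof.
set sa := \sum_i a i ^+ 2; set sb := \sum_i b i ^+ 2.
have sa0 : 0 <= sa by apply: sumr_ge0 => i _; apply: sqr_ge0.
have sb0 : 0 <= sb by apply: sumr_ge0 => i _; apply: sqr_ge0.
set sab := \sum_i a i * b i.
(* Lagrange's identity: the difference is half of this double sum of squares *)
have lagrange : sab ^+ 2 <= sa * sb.
  have : 0 <= \sum_i \sum_j (a i * b j - a j * b i) ^+ 2.
    by apply: sumr_ge0 => i _; apply: sumr_ge0 => j _; apply: sqr_ge0.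
  suff -> : \sum_i \sum_j (a i * b j - a j * b i) ^+ 2 =
    sa * sb + - 2 * (sab * sab) + sb * sa by rewrite expr2; lra.
  rewrite /sa /sb /sab !big_distrlr /= mulr_sumr -!big_split /=.
  apply: eq_bigr => i _; rewrite mulr_sumr -!big_split /=.
  by apply: eq_bigr => j _; ring.
have cs : sab <= Num.sqrt sa * Num.sqrt sb.
  apply: le_trans (ler_norm _) _.
  by rewrite -sqrtr_sqr -sqrtrM // ler_wsqrtr.
have sum2 : \sum_i (a i + b i) ^+ 2 = sa + 2 * sab + sb.
  rewrite /sa /sb /sab mulr_sumr -!big_split /=.
  by apply: eq_bigr => i _; ring.
rewrite sum2 -[leRHS]ger0_norm ?addr_ge0 ?sqrtr_ge0 // -sqrtr_sqr.
by apply: ler_wsqrtr; rewrite sqrrD !sqr_sqrtr //; lra.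
Qed.
End Norms.

(** * The Euclidean norm and the operator norm *)

Section EuclideanNorm.
Variables (R : realType) (d : nat).
Implicit Types (v w : 'cV[R[i]]_d) (M : 'M[R[i]]_d).

Lemma euclid_norm_ge0 v : 0 <= euclid_norm v.
Proof. exact: sqrtr_ge0. Qed.

Lemma euclid_normD v w : euclid_norm (v + w) <= euclid_norm v + euclid_norm w.
Proof.
apply: le_trans (minkowski_sum _ _); apply: ler_wsqrtr; apply: ler_sum => k _.
by rewrite mxE lerXn2r ?nnegrE ?addr_ge0 ?normc_ge0 // normcD.
Qed.

Lemma euclid_normZ (c : R[i]) v : euclid_norm (c *: v) = normc c * euclid_norm v.
Proof.
rewrite -[normc c]ger0_norm ?normc_ge0 // -sqrtr_sqr -sqrtrM ?sqr_ge0 //.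
congr Num.sqrt; rewrite mulr_sumr; apply: eq_bigr => k _.
by rewrite mxE ComplexField.Normc.normcM exprMn.
Qed.

Lemma euclid_normZr (x : R) v : euclid_norm (x%:C *: v) = `|x| * euclid_norm v.
Proof. by rewrite euclid_normZ normc_real. Qed.

Lemma euclid_norm0 : euclid_norm (0 : 'cV[R[i]]_d) = 0.
Proof. by rewrite -(scale0r 0) euclid_normZ ComplexField.Normc.normc0 mul0r. Qed.

Lemma euclid_normN v : euclid_norm (- v) = euclid_norm v.
Proof.
by rewrite -scaleN1r euclid_normZ normcN ComplexField.Normc.normc1 mul1r.
Qed.

Lemma euclid_normB v w : euclid_norm (v - w) <= euclid_norm v + euclid_norm w.
Proof. by rewrite -[euclid_norm w]euclid_normN euclid_normD. Qed.

Lemma euclid_distC v w : euclid_norm (v - w) = euclid_norm (w - v).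
Proof. by rewrite -euclid_normN opprB. Qed.

Lemma euclid_norm_dist v w : `|euclid_norm v - euclid_norm w| <= euclid_norm (v - w).
Proof.
have := euclid_normD (v - w) w; have := euclid_normD (w - v) v.
by rewrite !subrK (euclid_distC w v) ler_norml; lra.
Qed.

Lemma euclid_norm_eq0 v : euclid_norm v = 0 -> v = 0.
Proof.
move=> /eqP; rewrite sqrtr_eq0 => le0.
have sq_ge0 (k : 'I_d) : true -> 0 <= normc (v k 0) ^+ 2 by rewrite sqr_ge0.
have : \sum_(k < d) normc (v k 0) ^+ 2 == 0.
  by rewrite eq_le le0 sumr_ge0.
rewrite psumr_eq0 // => /allP h; apply/matrixP => k l; rewrite ord1 mxE.
have := h k (mem_index_enum _); rewrite sqrf_eq0 => /eqP.
exact: ComplexField.Normc.eq0_normc.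
Qed.

Lemma entry_le_euclid_norm v k : normc (v k 0) <= euclid_norm v.
Proof.
rewrite -[leLHS]ger0_norm ?normc_ge0 // -sqrtr_sqr; apply: ler_wsqrtr.
by rewrite (bigD1 k) //= lerDl sumr_ge0 // => i _; apply: sqr_ge0.
Qed.

Lemma euclid_norm_le_sum v : euclid_norm v <= \sum_k normc (v k 0).
Proof.
have s0 : 0 <= \sum_k normc (v k 0) by apply: sumr_ge0 => k _; apply: normc_ge0.
rewrite -[leRHS]ger0_norm // -sqrtr_sqr; apply: ler_wsqrtr.
rewrite expr2 mulr_suml; apply: ler_sum => k _; rewrite expr2.
apply: ler_wpM2l; first exact: normc_ge0.
by rewrite (bigD1 k) //= lerDl sumr_ge0 // => i _; apply: normc_ge0.
Qed.

(** An auxiliary norm that bounds the two others and, unlike them, compares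
    directly with the entries; it carries the topological arguments. *)
Definition entry_norm n m (M : 'M[R[i]]_(n, m)) : R := \sum_i \sum_j normc (M i j).

Lemma entry_norm_ge0 n m (M : 'M[R[i]]_(n, m)) : 0 <= entry_norm M.
Proof. by apply: sumr_ge0 => i _; apply: sumr_ge0 => j _; apply: normc_ge0. Qed.

Lemma euclid_norm_le_entry v : euclid_norm v <= entry_norm v.
Proof.
apply: le_trans (euclid_norm_le_sum v) _.
by apply: ler_sum => k _; rewrite big_ord1.
Qed.

Lemma euclid_mulmx_entry M v :
  euclid_norm (M *m v) <= entry_norm M * euclid_norm v.
Proof.
apply: le_trans (euclid_norm_le_sum _) _; rewrite mulr_suml.
apply: ler_sum => i _; rewrite mxE mulr_suml.
apply: le_trans (normc_sum _ _ _) _; apply: ler_sum => j _.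
by rewrite ComplexField.Normc.normcM ler_wpM2l ?normc_ge0 ?entry_le_euclid_norm.
Qed.

Let ball_image M :=
  [set euclid_norm (M *m v) | v in [set v | euclid_norm v <= 1]].

Let ball_image0 M : ball_image M 0.
Proof.
by exists 0; rewrite /= ?mulmx0 !euclid_norm0 ?ler01.
Qed.

Let ball_image_ub M : ubound (ball_image M) (entry_norm M).
Proof.
move=> _ [v /= v1 <-]; apply: le_trans (euclid_mulmx_entry M v) _.
by rewrite -[leRHS]mulr1 ler_wpM2l ?entry_norm_ge0.
Qed.

Let op_norm_ub M : ubound (ball_image M) (op_norm M).
Proof.
apply: sup_upper_bound; split; first by exists 0.
by exists (entry_norm M).
Qed.

Lemma op_norm_ge0 M : 0 <= op_norm M.
Proof. exact: op_norm_ub. Qed.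

Lemma op_norm_le_entry M : op_norm M <= entry_norm M.
Proof.
apply: (@ge_sup _ (ball_image M)); last exact: ball_image_ub.
by exists 0; apply: ball_image0.
Qed.

(** Homogeneity reduces to the unit ball, on which the supremum is an upper
    bound because [entry_norm M] bounds the set. *)
Lemma euclid_mulmx M v : euclid_norm (M *m v) <= op_norm M * euclid_norm v.
Proof.
have [/euclid_norm_eq0 ->|v0] := eqVneq (euclid_norm v) 0.
  by rewrite mulmx0 euclid_norm0 mulr0.
have v_gt0 : 0 < euclid_norm v by rewrite lt_neqAle eq_sym v0 euclid_norm_ge0.
have vE : v = (euclid_norm v)%:C *: ((euclid_norm v)^-1%:C *: v).
  by rewrite scalerA -rmorphM /= divff // scale1r.
rewrite {1}vE -scalemxAr euclid_normZr ger0_norm ?euclid_norm_ge0 // mulrC.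
rewrite ler_wpM2r ?euclid_norm_ge0 //; apply: op_norm_ub.
exists ((euclid_norm v)^-1%:C *: v) => //=.
by rewrite euclid_normZr ger0_norm ?invr_ge0 ?euclid_norm_ge0 // mulVf.
Qed.

End EuclideanNorm.

(** * Continuity and derivatives in terms of norms *)

Section EntryNormTopology.
Variable R : realType.

Lemma entry_norm_dist m n (M P : 'M[R[i]]_(m, n)) :
  `|entry_norm M - entry_norm P| <= entry_norm (M - P).
Proof.
rewrite /entry_norm -sumrB; apply: le_trans (ler_norm_sum _ _ _) _.
apply: ler_sum => i _; rewrite -sumrB; apply: le_trans (ler_norm_sum _ _ _) _.
apply: ler_sum => j _; rewrite !mxE; set a := M i j; set b := P i j.
have := normcD (a - b) b; have := normcD (b - a) a.
have := normcN (b - a).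
by rewrite !subrK opprB ler_norml; lra.
Qed.

Lemma entry_normZ m n (c : R[i]) (M : 'M[R[i]]_(m, n)) :
  entry_norm (c *: M) = normc c * entry_norm M.
Proof.
rewrite mulr_sumr; apply: eq_bigr => i _; rewrite mulr_sumr.
by apply: eq_bigr => j _; rewrite mxE ComplexField.Normc.normcM.
Qed.

Lemma entry_norm_lt_mx_norm m n (M : 'M[R[i]]_(m, n)) (e : R) :
  `|M| < e%:C -> entry_norm M <= (m * n)%:R * e.
Proof.
move=> Me; have ent i j : normc (M i j) <= e.
  have : `|M i j| <= `|M|.
    rewrite [leRHS]/Num.Def.normr /= mx_normE.
    by rewrite -[leLHS]nngE num_le; exact: (le_bigmax _ _ (i, j)).
  by move=> le_M; apply: ltW; rewrite -ltcR; exact: le_lt_trans le_M Me.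
apply: (@le_trans _ _ (\sum_(i < m) \sum_(j < n) e)).
  by apply: ler_sum => i _; apply: ler_sum.
by rewrite !sumr_const !card_ord -mulrnA mulr_natl mulnC.
Qed.

(** The topological norm of a complex matrix is itself a complex number; here
    convergence is expressed with a real radius. *)
Lemma cvg_entry_norm (F : set_system R) (FF : Filter F) m n
    (f : R -> 'M[R[i]]_(m, n)) (l : 'M[R[i]]_(m, n)) (e : R) :
  f t @[t --> F] --> l -> 0 < e -> \forall t \near F, entry_norm (f t - l) < e.
Proof.
move=> fl e0.
pose k : R := (m * n)%:R + 1.
have k0 : 0 < k by rewrite ltr_wpDl ?ler0n.
have ek0 : 0 < (e / k)%:C by rewrite ltcR divr_gt0.
move/cvgrPdist_lt/(_ _ ek0) : fl; apply: filterS => t.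
rewrite distrC => /entry_norm_lt_mx_norm /le_lt_trans; apply.
by rewrite mulrA ltr_pdivrMr // mulrC ltr_pM2l // /k ltrDl.
Qed.

(** The extreme value theorem applied to the real function [entry_norm \o f]. *)
Lemma cont_on_bounded m n (f : R -> 'M[R[i]]_(m, n)) :
  cont_on f -> exists2 K : R, 0 <= K & forall t, I11 R t -> entry_norm (f t) <= K.
Proof.
move=> cf.
have cg : {within `[(-1 : R), 1], continuous (fun t => entry_norm (f t))}.
  move=> x; apply/cvgrPdist_lt => e e0.
  have := cvg_entry_norm (nbhs_filter x) (cf x) e0; apply: filterS => t h.
  by rewrite distrC; exact: le_lt_trans (entry_norm_dist _ _) h.
have [|c _ cmax] := EVT_max _ cg; first by lra.
exists (entry_norm (f c)); first exact: entry_norm_ge0.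
by move=> t It; apply: cmax.
Qed.

(** The derivative as a first-order expansion, the form in which every
    derivative is used below. *)
Lemma is_derive_on_eps m n (f : R -> 'M[R[i]]_(m, n)) t l (e : R) :
  is_derive_on f t l -> 0 < e ->
  exists2 delta : R, 0 < delta & forall s, I11 R s -> `|s - t| < delta ->
    entry_norm (f s - f t - (s - t)%:C *: l) <= e * `|s - t|.
Proof.
move=> /cvg_entry_norm fl e0; have := fl _ e0.
rewrite near_withinE => -[delta /= delta0 h]; exists delta => // s Is st.
have [->|nst] := eqVneq s t.
  rewrite !subrr scale0r subr0 normr0 mulr0 -(scale0r 0) entry_normZ.
  by rewrite ComplexField.Normc.normc0 mul0r.
have st0 : (s - t)%:C != 0 :> R[i] by rewrite fmorph_eq0 subr_eq0.
have -> : f s - f t - (s - t)%:C *: l =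
    (s - t)%:C *: (((s - t)^-1)%:C *: (f s - f t) - l).
  by rewrite scalerBr scalerA fmorphV divff // scale1r.
rewrite entry_normZ normc_real mulrC ler_wpM2r // ltW //.
by apply: h => //=; rewrite distrC.
Qed.
End EntryNormTopology.

(** * From local to global estimates *)

Section LocalToGlobal.
Variable R : realType.

(** The supremum [c] of the points [t] with [P a t] belongs to them, by the
    local hypothesis on the left of [c] and transitivity; the local hypothesis
    on the right of [c] forces [c = b]. *)
Lemma interval_induction (P : R -> R -> Prop) (a b : R) :
  a <= b ->
  (forall r s t, r <= s -> s <= t -> P r s -> P s t -> P r t) ->
  (forall c, a <= c -> c <= b -> exists2 delta : R, 0 < delta &
     (forall s, a <= s -> s <= c -> c - s < delta -> P s c) /\
     (forall t, c <= t -> t <= b -> t - c < delta -> P c t)) ->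
  P a b.
Proof.
move=> ab trP locP.
pose S := [set t | a <= t /\ t <= b /\ P a t].
have Sa : S a.
  have [delta delta0 [_ Pa]] := locP a (lexx _) ab.
  by split=> //; split=> //; apply: Pa => //; rewrite subrr.
have supS : has_sup S.
  by split; [exists a | exists b => t [_ []]].
have ac : a <= sup S by apply: sup_upper_bound.
have cb : sup S <= b by apply: ge_sup; [exists a | move=> t [_ []]].
have [delta delta0 [Pl Pr]] := locP _ ac cb.
have [t [at_ [tb Pat]] ct] := sup_adherent delta0 supS.
have tc : t <= sup S by apply: sup_upper_bound.
have Pac : P a (sup S).
  by apply: trP Pat (Pl t _ _ _) => //; lra.
have [<- //|ncb] := eqVneq (sup S) b.
have {ncb}cb' : sup S < b by rewrite lt_neqAle ncb.
pose t' := Num.min b (sup S + delta / 2).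
have ct' : sup S < t' by rewrite lt_min cb' /=; lra.
have t'b : t' <= b by rewrite ge_min lexx.
have t'd : t' <= sup S + delta / 2 by rewrite ge_min lexx orbT.
suff : t' <= sup S by lra.
apply: sup_upper_bound => //; split; first by lra.
by split=> //; apply: trP Pac (Pr t' _ _ _) => //; lra.
Qed.
End LocalToGlobal.

(** * Invertibility of the fundamental solution *)

Section FundamentalSolution.
Variable R : realType.

(** Backward uniqueness.  For [eta > 0] the positive function [g = f + eta]
    varies at relative rate at most [L > K], so [g s <= exp (2 L (t - s)) g t]
    for [s <= t] (the factor 2 absorbs the first-order error).  As [f b = 0],
    this gives [f a + eta <= exp (2 L (b - a)) eta], and [eta] is arbitrary. *)
Lemma gronwall_zero (f : R -> R) (K a b : R) :
  a <= b -> (forall t, 0 <= f t) ->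
  (forall c e, a <= c -> c <= b -> 0 < e -> exists2 delta : R, 0 < delta &
     forall s, a <= s -> s <= b -> `|s - c| < delta ->
       `|f s - f c| <= (K * f c + e) * `|s - c|) ->
  f b = 0 -> f a = 0.
Proof.
move=> ab f0 locf fb0.
pose L := `|K| + 1.
have L0 : 0 < L by rewrite ltr_wpDl.
have KL : K <= L by rewrite /L; have := ler_norm K; lra.
suff small eta : 0 < eta -> f a + eta <= expR (2 * L * (b - a)) * eta.
  apply/eqP; rewrite eq_le f0 andbT leNgt; apply/negP => fa0.
  set k := expR _ in small; have k0 : 0 < k by apply: expR_gt0.
  have := small (f a / k) (divr_gt0 fa0 k0).
  rewrite mulrCA divff ?gt_eqF // mulr1.
  by have := divr_gt0 fa0 k0; lra.
move=> eta0.
pose g t := f t + eta.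
have g0 t : 0 < g t by rewrite /g; have := f0 t; lra.
suff : g a <= expR (2 * L * (b - a)) * g b by rewrite /g fb0 add0r.
apply: (@interval_induction R
  (fun s t => g s <= expR (2 * L * (t - s)) * g t) a b ab).
  move=> r s t _ _ rs st; apply: le_trans rs _.
  rewrite (_ : 2 * L * (t - r) = 2 * L * (s - r) + 2 * L * (t - s)); last by ring.
  by rewrite expRD -[leRHS]mulrA ler_pM2l ?expR_gt0.
move=> c ac cb.
have [|delta delta0 hdelta] := locf c (L * eta) ac cb; first exact: mulr_gt0.
(* the error [L * eta] is what turns [K * f c] into a multiple of [g c] *)
have dg s : a <= s -> s <= b -> `|s - c| < delta ->
    `|g s - g c| <= L * g c * `|s - c|.
  move=> as_ sb sc; rewrite (_ : g s - g c = f s - f c); last by rewrite /g; ring.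
  apply: le_trans (hdelta s as_ sb sc) _.
  rewrite ler_wpM2r // /g mulrDr lerD2r ler_wpM2r //.
(* on the right of [c] one needs [1 <= (1 + 2 z) (1 - z)], [z = L (t - c)],
   which holds as soon as [z <= 1 / 2] *)
exists (Num.min delta (1 / (2 * L))).
  by rewrite lt_min delta0 divr_gt0 // mulr_gt0.
split=> [s as_ sc|t ct tb]; rewrite lt_min => /andP[sdelta sL].
  have := dg s as_ (le_trans sc cb); rewrite distrC ger0_norm ?subr_ge0 //.
  move=> /(_ sdelta); rewrite ler_norml => /andP[_ h].
  have := expR_ge1Dx (2 * L * (c - s)).
  have := g0 c.
  have : 0 <= L * (c - s) by rewrite mulr_ge0 ?subr_ge0 // ltW.
  by nra.
have := dg t (le_trans ac ct) tb; rewrite ger0_norm ?subr_ge0 //.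
move=> /(_ sdelta); rewrite ler_norml => /andP[h _].
have := expR_ge1Dx (2 * L * (t - c)).
have gt0 := g0 t; have gc0 := g0 c.
have Lh0 : 0 <= L * (t - c) by rewrite mulr_ge0 ?subr_ge0 // ltW.
have Lh1 : L * (t - c) <= 1 / 2.
  move: sL; rewrite ltr_pdivlMr ?mulr_gt0 //; nra.
move: h Lh0 Lh1; rewrite -[2 * L * _]mulrA [L * g c * _]mulrAC.
set z := L * (t - c); set E := expR _ => h z0 z1 hE.
have : (1 + 2 * z) * g t <= E * g t by rewrite ler_pM2r.
have : 0 <= z * (1 - 2 * z) * g c.
  by rewrite mulr_ge0 ?(ltW gc0) // mulr_ge0 //; lra.
have : (1 + 2 * z) * (g c - z * g c) <= (1 + 2 * z) * g t.
  by rewrite ler_pM2l; lra.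
by nra.
Qed.

Lemma is_derive_on_mulmx d (f : R -> 'M[R[i]]_d) t l (v : 'cV[R[i]]_d) (e : R) :
  is_derive_on f t l -> 0 < e ->
  exists2 delta : R, 0 < delta & forall s, I11 R s -> `|s - t| < delta ->
    euclid_norm (f s *m v - f t *m v - (s - t)%:C *: (l *m v)) <= e * `|s - t|.
Proof.
move=> fl e0.
have v1 : 0 < euclid_norm v + 1 by rewrite ltr_wpDl ?euclid_norm_ge0.
have [delta delta0 h] := is_derive_on_eps fl (divr_gt0 e0 v1).
exists delta => // s Is st.
rewrite scalemxAl -!mulmxBl; apply: le_trans (euclid_mulmx_entry _ _) _.
apply: le_trans (ler_wpM2r (euclid_norm_ge0 v) (h s Is st)) _.
rewrite mulrAC; apply: ler_wpM2r => //.
by rewrite mulrAC ler_pdivrMr // ler_pM2l // lerDl.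
Qed.

Lemma I11P (t : R) : I11 R t <-> -1 <= t /\ t <= 1.
Proof. by rewrite /I11 /= in_itv /=; split=> [/andP[]|[-> ->]]. Qed.

(** If [Phi t v = 0], then [Phi v] solves [x' = A x] and vanishes at [t], hence
    at [-1], where it equals [v]. *)
Lemma fundamental_solution_unit d (A Phi : R -> 'M[R[i]]_d) t :
  cont_on A -> is_fundamental_solution A Phi -> I11 R t -> Phi t \in unitmx.
Proof.
move=> /cont_on_bounded[K K0 AK] [dPhi Phi1] It.
have [t1 t2] := (I11P t).1 It.
suff ker0 (v : 'cV_d) : Phi t *m v = 0 -> v = 0.
  rewrite -unitmx_tr -row_free_unit; apply: inj_row_free => v vP.
  apply: trmx_inj; rewrite trmx0; apply: ker0.
  by rewrite -[Phi t]trmxK -trmx_mul vP trmx0.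
move=> Pv0; apply: euclid_norm_eq0.
have := @gronwall_zero (fun s => euclid_norm (Phi s *m v)) K (-1) t t1.
rewrite /= Phi1 mul1mx; apply => [s|c e c1 ct e0|]; first exact: euclid_norm_ge0.
  have Ic : I11 R c by apply/I11P; lra.
  have [delta delta0 h] := is_derive_on_mulmx v (dPhi c Ic) e0.
  exists delta => // s s1 st sc.
  apply: le_trans (euclid_norm_dist _ _) _.
  have {}h := h s ltac:(apply/I11P; lra) sc.
  have := euclid_normD (Phi s *m v - Phi c *m v - (s - c)%:C *: (A c *m Phi c *m v))
    ((s - c)%:C *: (A c *m Phi c *m v)).
  rewrite subrK => /le_trans; apply.
  rewrite addrC mulrDl lerD // euclid_normZr mulrC ler_wpM2r // -mulmxA.
  apply: le_trans (euclid_mulmx_entry _ _) _.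
  by rewrite ler_wpM2r ?euclid_norm_ge0 ?AK.
by rewrite Pv0 euclid_norm0.
Qed.
End FundamentalSolution.

(** * Stability of the inhomogeneous equation *)

Section VariationOfConstants.
Variables (R : realType) (d : nat) (A Phi : R -> 'M[R[i]]_d) (C_A : R).
Hypothesis dPhi : is_fundamental_solution A Phi.
Hypothesis unitPhi : forall t, I11 R t -> Phi t \in unitmx.
Hypothesis hC : forall s t : R, -1 <= s -> s <= t -> t <= 1 ->
  op_norm (Phi t *m invmx (Phi s)) <= C_A.

Lemma stability_constant_ge0 : 0 <= C_A.
Proof.
apply: (le_trans (op_norm_ge0 (Phi 1 *m invmx (Phi (-1))))).
by apply: hC => //; lra.
Qed.

(** Variation of constants for [e' = A e + r] without the integral: the
    increments of [w s = Phi t (Phi s)^-1 e s] are estimated near each point [c],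
    then added up.  With [z = (Phi c)^-1 e c] one has exactly
    [w s - w c = Phi t (Phi s)^-1 (e s - Phi s z)], and [e] and [Phi z] are equal
    at [c], with derivatives there that differ by [r c]; so only the bound on
    [Phi t (Phi s)^-1] is needed, and no regularity of the inverse. *)
Lemma inhomogeneous_bound (e r : R -> 'cV[R[i]]_d) (E : R) :
  (forall c eps, I11 R c -> 0 < eps -> exists2 delta : R, 0 < delta &
     forall s, I11 R s -> `|s - c| < delta ->
       euclid_norm (e s - e c - (s - c)%:C *: (A c *m e c + r c))
         <= eps * `|s - c|) ->
  (forall c, I11 R c -> euclid_norm (r c) <= E) ->
  e (-1) = 0 ->
  forall t, I11 R t -> euclid_norm (e t) <= 2 * C_A * E.
Proof.
move=> de rE e0 t It; have [t1 t2] := (I11P t).1 It.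
have CA0 := stability_constant_ge0.
have E0 : 0 <= E by apply: le_trans (euclid_norm_ge0 _) (rE t It).
suff bound eps : 0 < eps -> euclid_norm (e t) <= C_A * (E + eps) * (t + 1).
  apply/ler_addgt0Pr => eps eps0.
  have k0 : 0 < 2 * C_A + 1 by lra.
  apply: le_trans (bound _ (divr_gt0 eps0 k0)) _.
  set x := eps / _; have x0 : 0 < x by apply: divr_gt0.
  have xE : x * (2 * C_A + 1) = eps by rewrite /x divfK // gt_eqF.
  have CE : 0 <= C_A * (E + x) by rewrite mulr_ge0 //; lra.
  by rewrite -xE; nra.
move=> eps0.
pose G s := Phi t *m invmx (Phi s).
pose w s := G s *m e s.
have wt : w t = e t by rewrite /w /G mulmxV ?unitPhi // mul1mx.
have w1 : w (-1) = 0 by rewrite /w e0 mulmx0.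
suff : euclid_norm (w (-1) - w t) <= C_A * (E + eps) * (t - -1).
  by rewrite w1 wt sub0r euclid_normN opprK.
apply: (@interval_induction R (fun s s' =>
    euclid_norm (w s - w s') <= C_A * (E + eps) * (s' - s)) _ _ t1).
  move=> s1 s2 s3 _ _ h12 h23.
  rewrite (_ : w s1 - w s3 = (w s1 - w s2) + (w s2 - w s3)); last first.
    by rewrite addrA subrK.
  apply: le_trans (euclid_normD _ _) _.
  apply: le_trans (lerD h12 h23) _.
  by rewrite -mulrDr (_ : s2 - s1 + (s3 - s2) = s3 - s1) //; ring.
suff locw c : -1 <= c -> c <= t -> exists2 delta : R, 0 < delta &
    forall s, -1 <= s -> s <= t -> `|s - c| < delta ->
      euclid_norm (w s - w c) <= C_A * (E + eps) * `|s - c|.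
  move=> c c1 ct; have [delta delta0 h] := locw c c1 ct; exists delta => //.
  split=> [s s1 sc scd|s cs st scd].
    have scE : `|s - c| = c - s by rewrite distrC ger0_norm ?subr_ge0.
    by rewrite -scE; apply: h; rewrite ?scE // (le_trans sc).
  have scE : `|s - c| = s - c by rewrite ger0_norm ?subr_ge0.
  by rewrite euclid_distC -scE; apply: h; rewrite ?scE // (le_trans c1).
move=> c1 ct.
have Ic : I11 R c by apply/I11P; lra.
have eps2 : 0 < eps / 2 by lra.
pose z := invmx (Phi c) *m e c.
have Phiz : Phi c *m z = e c by rewrite /z mulKVmx ?unitPhi.
have [d1 d1_0 he] := de c _ Ic eps2.
have [d2 d2_0 hPhi] := is_derive_on_mulmx z (dPhi.1 c Ic) eps2.
exists (Num.min d1 d2); first by rewrite lt_min d1_0.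
move=> s s1 st; rewrite lt_min => /andP[sd1 sd2].
have Is : I11 R s by apply/I11P; lra.
have := hPhi s Is sd2; rewrite -mulmxA Phiz => {}hPhi.
have {}he := he s Is sd1.
have -> : w s - w c = G s *m (e s - Phi s *m z).
  by rewrite mulmxBr /w /G /z !mulmxA mulmxKV ?unitPhi.
apply: le_trans (euclid_mulmx _ _) _; rewrite -mulrA.
apply: ler_pM; rewrite ?op_norm_ge0 ?euclid_norm_ge0 ?hC //.
set x := e s - e c - _ in he; set y := Phi s *m z - _ - _ in hPhi.
have -> : e s - Phi s *m z = x - y + (s - c)%:C *: r c.
  rewrite /x /y scalerDr !opprD !opprK.
  by apply/matrixP => i j; rewrite !mxE; ring.
apply: le_trans (euclid_normD _ _) _; rewrite mulrDl addrC lerD //.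
  by rewrite euclid_normZr mulrC ler_wpM2r ?rE.
apply: le_trans (euclid_normB x y) _; apply: le_trans (lerD he hPhi) _.
by rewrite -mulrDl -splitr.
Qed.

End VariationOfConstants.

(** * The cardinal polynomial of the node -1 *)

Section ChebyshevBoundary.
Variable R : realType.
Implicit Types (x t : R) (n N j : nat).

(** The pair [(T_n, U_(n-1))] of Chebyshev polynomials of the two kinds, with
    [U_(-1) = 0].  The joint recurrence is the addition formula for the angles
    [n x] and [x]. *)
Fixpoint cheb_pair n : {poly R} * {poly R} :=
  if n is m.+1 then
    let: (p, q) := cheb_pair m in ('X * p - (1 - 'X ^+ 2) * q, 'X * q + p)
  else (1, 0).

Local Notation chebT n := (cheb_pair n).1.
Local Notation chebS n := (cheb_pair n).2.

Lemma chebTS n :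
  chebT n.+1 = 'X * chebT n - (1 - 'X ^+ 2) * chebS n.
Proof. by rewrite /=; case: (cheb_pair n). Qed.

Lemma chebSS n : chebS n.+1 = 'X * chebS n + chebT n.
Proof. by rewrite /=; case: (cheb_pair n). Qed.

Lemma size_cheb n : (size (chebT n) <= n.+1)%N /\ (size (chebS n) <= n)%N.
Proof.
elim: n => [|n [sT sS]]; first by rewrite /= size_poly1 size_poly0.
have sXT : (size ('X * chebT n)%R <= n.+2)%N.
  by rewrite (leq_trans (size_polyMleq _ _)) // size_polyX.
have sXS : (size ('X * chebS n)%R <= n.+1)%N.
  by rewrite (leq_trans (size_polyMleq _ _)) // size_polyX.
have s2 : (size (1 - 'X ^+ 2 : {poly R})%R <= 3)%N.
  by rewrite (leq_trans (size_polyD _ _)) // size_polyN size_poly1 size_polyXn.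
have sqS : (size ((1 - 'X ^+ 2) * chebS n)%R <= n.+2)%N.
  rewrite (leq_trans (size_polyMleq _ _)) //.
  by rewrite -subn1 leq_subLR (leq_trans (leq_add s2 sS)).
rewrite chebTS chebSS; split.
  by rewrite (leq_trans (size_polyD _ _)) // size_polyN geq_max sXT.
by rewrite (leq_trans (size_polyD _ _)) // geq_max sXS.
Qed.

Lemma cheb_cos n x :
  (chebT n).[cos x] = cos (n%:R * x) /\
  (chebS n).[cos x] * sin x = sin (n%:R * x).
Proof.
elim: n => [|n [hT hS]].
  by rewrite /= hornerC horner0 !mul0r cos0 sin0.
rewrite chebTS chebSS -natr1 [(_ + 1) * x]mulrDl mul1r cosD sinD -hT -hS.
rewrite !hornerE; split; last by ring.
by rewrite -(cos2Dsin2 x); ring.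
Qed.

(** From [U_n = X U_(n-1) + T_n] by induction; dividing [sin (n x)] by [sin x]
    would leave out the endpoints of the interval. *)
Lemma normr_chebS n t : -1 <= t <= 1 -> `|(chebS n).[t]| <= n%:R.
Proof.
move=> t1; have tcos := (acos_def t1).2; have {}t1 : `|t| <= 1 by rewrite ler_norml.
elim: n => [|n IH]; first by rewrite /= horner0 normr0.
have T1 : `|(chebT n).[t]| <= 1 by rewrite -tcos (cheb_cos n _).1 cos_max.
rewrite chebSS !hornerE -natr1; apply: le_trans (ler_normD _ _) _.
apply: lerD => //; rewrite normrM.
by rewrite -[leRHS]mul1r ler_pM.
Qed.

Lemma chebN1 n :
  (chebT n).[-1] = (-1) ^+ n /\ (chebS n).[-1] = - (-1) ^+ n * n%:R.
Proof.
elim: n => [|n [hT hS]]; first by rewrite /= hornerC horner0 mulr0.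
by rewrite chebTS chebSS !hornerE hT hS [_ ^+ n.+1]exprS -natr1; split; ring.
Qed.

Lemma sin_pi_nat j : sin (pi * j%:R) = 0 :> R.
Proof.
elim: j => [|j IH]; first by rewrite mulr0 sin0.
by rewrite -natr1 mulrDr mulr1 sinDpi IH oppr0.
Qed.

Lemma cheb_node_last N : (0 < N)%N -> cheb_node R N N = -1.
Proof. by move=> N0; rewrite /cheb_node mulfK ?pnatr_eq0 -?lt0n // cospi. Qed.

(** The polynomial is [(X - 1) U_(N-1)] divided by its value at [-1]: the roots of
    [U_(N-1)] are the interior nodes, [1] is the node [t_0], and both factors
    attain their largest modulus, [2] and [N], at [-1]. *)
Lemma cheb_boundary_cardinal N : (0 < N)%N ->
  exists l : {poly R}, [/\ (size l <= N.+1)%N,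
    forall j, (j < N)%N -> l.[cheb_node R N j] = 0,
    l.[-1] = 1 & forall t, -1 <= t <= 1 -> `|l.[t]| <= 1].
Proof.
move=> N0.
have NR : 0 < N%:R :> R by rewrite ltr0n.
pose b := ('X - 1) * chebS N.
have bE t : b.[t] = (t - 1) * (chebS N).[t] by rewrite /b !hornerE.
have bN1 : `|b.[-1]| = 2 * N%:R.
  rewrite bE (chebN1 N).2 normrM [`|- _ * _|]normrM normrN normrX normrN1 expr1n.
  by rewrite mul1r normr_nat -opprD normrN ger0_norm.
have b0 : b.[-1] != 0 by rewrite -normr_gt0 bN1 mulr_gt0.
exists (b.[-1]^-1 *: b); split.
- rewrite (leq_trans (size_scale_leq _ _)) // (leq_trans (size_polyMleq _ _)) //.
  by rewrite size_XsubC /= ltnS (size_cheb N).2.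
- move=> [|j] jN; rewrite hornerZ [b.[cheb_node _ _ _]]bE.
    by rewrite /cheb_node mulr0 mul0r cos0 subrr mul0r mulr0.
  rewrite /cheb_node; set x := pi * _ / _.
  have sx : sin x != 0.
    rewrite gt_eqF // sin_gt0_pi // /x; apply/andP; split.
      by rewrite divr_gt0 // mulr_gt0 ?pi_gt0 ?ltr0n.
    by rewrite ltr_pdivrMr // ltr_pM2l ?pi_gt0 // ltr_nat.
  have : (chebS N).[cos x] * sin x = 0.
    by rewrite (cheb_cos N x).2 /x mulrC divfK ?gt_eqF // sin_pi_nat.
  by move/eqP; rewrite mulf_eq0 (negbTE sx) orbF => /eqP ->; rewrite !mulr0.
- by rewrite hornerZ mulVf.
- move=> t t1; rewrite hornerZ normrM normfV bN1 mulrC ler_pdivrMr ?mulr_gt0 //.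
  rewrite mul1r bE normrM ler_pM ?normr_chebS //.
  by move/andP: t1 => [? ?]; rewrite ler_norml; apply/andP; split; lra.
Qed.
End ChebyshevBoundary.

(** * Vector-valued polynomials and uniform norms *)

Section VectorPolynomials.
Variables (R : realType) (d : nat).

Lemma poly_bounded_on (q : {poly R[i]}) :
  exists2 K : R, 0 <= K & forall t, I11 R t -> normc q.[t%:C] <= K.
Proof.
exists (\sum_(i < size q) normc q`_i).
  by apply: sumr_ge0 => i _; apply: normc_ge0.
move=> t /I11P[t1 t2]; rewrite horner_coef; apply: le_trans (normc_sum _ _ _) _.
apply: ler_sum => i _.
rewrite ComplexField.Normc.normcM -rmorphXn normc_real normrX.
by rewrite ler_piMr ?normc_ge0 // exprn_ile1 // ler_norml t1.
Qed.

(** Factoring [X - t] out of [q - q(t)], and once more out of the quotient, whose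
    value at [t] is [q'(t)], leaves [(s - t)^2 h(s)]; and [h] is bounded. *)
Lemma poly_second_order (q : {poly R[i]}) (t : R) :
  exists2 K : R, 0 <= K & forall s, I11 R s ->
    normc (q.[s%:C] - q.[t%:C] - (s - t)%:C * q^`().[t%:C]) <= K * `|s - t| ^+ 2.
Proof.
have /factor_theorem[g gE] : root (q - (q.[t%:C])%:P) t%:C.
  by rewrite rootE !hornerE subrr.
have /factor_theorem[h hE] : root (g - (g.[t%:C])%:P) t%:C.
  by rewrite rootE !hornerE subrr.
have qE : q = g * ('X - (t%:C)%:P) + (q.[t%:C])%:P by rewrite -gE subrK.
have dqE : q^`().[t%:C] = g.[t%:C].
  by rewrite qE derivD derivM derivC derivXsubC addr0 mulr1 !hornerE subrr mulr0 add0r.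
have [K K0 hK] := poly_bounded_on h; exists K => // s Is.
have -> : q.[s%:C] - q.[t%:C] - (s - t)%:C * q^`().[t%:C] =
    (s - t)%:C ^+ 2 * h.[s%:C].
  have /(congr1 (fun r : {poly R[i]} => r.[s%:C])) := gE.
  have /(congr1 (fun r : {poly R[i]} => r.[s%:C])) := hE.
  rewrite !hornerE dqE rmorphB /= => hs ->.
  rewrite -(subrK g.[t%:C] g.[s%:C]) hs; ring.
rewrite ComplexField.Normc.normcM -rmorphXn normc_real normrX mulrC.
by rewrite ler_wpM2r ?hK // exprn_ge0.
Qed.

Implicit Types p q : 'cV[{poly R[i]}]_d.

Lemma vpoly_evalD p q t : vpoly_eval (p + q) t = vpoly_eval p t + vpoly_eval q t.
Proof. by apply/matrixP => i j; rewrite !mxE hornerD. Qed.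

Lemma vpoly_evalN p t : vpoly_eval (- p) t = - vpoly_eval p t.
Proof. by apply/matrixP => i j; rewrite !mxE hornerN. Qed.

Lemma vpoly_bounded_on p :
  exists2 K : R, 0 <= K & forall t, I11 R t -> euclid_norm (vpoly_eval p t) <= K.
Proof.
have H k : exists K : R, 0 <= K /\ forall t, I11 R t -> normc (p k 0).[t%:C] <= K.
  by have [K K0 hK] := poly_bounded_on (p k 0); exists K.
have [K hK] := boolp.choice H.
exists (\sum_k K k); first by apply: sumr_ge0 => k _; case: (hK k).
move=> t It; apply: le_trans (euclid_norm_le_sum _) _.
by apply: ler_sum => k _; rewrite mxE; apply: (hK k).2.
Qed.

Lemma vpoly_is_derive p t (e : R) : 0 < e ->
  exists2 delta : R, 0 < delta & forall s, I11 R s -> `|s - t| < delta ->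
    euclid_norm (vpoly_eval p s - vpoly_eval p t
                 - (s - t)%:C *: vpoly_eval (vpoly_deriv p) t) <= e * `|s - t|.
Proof.
move=> e0.
have H k : exists K : R, 0 <= K /\ forall s, I11 R s ->
    normc ((p k 0).[s%:C] - (p k 0).[t%:C] - (s - t)%:C * (p k 0)^`().[t%:C])
      <= K * `|s - t| ^+ 2.
  by have [K K0 hK] := poly_second_order (p k 0) t; exists K.
have [K hK] := boolp.choice H.
have sK0 : 0 <= \sum_k K k by apply: sumr_ge0 => k _; case: (hK k).
have sK1 : 0 < \sum_k K k + 1 by lra.
exists (e / (\sum_k K k + 1)); first exact: divr_gt0.
move=> s Is; rewrite ltr_pdivlMr // => st.
apply: le_trans (euclid_norm_le_sum _) _.
apply: (@le_trans _ _ (\sum_k K k * `|s - t| ^+ 2)).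
  by apply: ler_sum => k _; rewrite !mxE; apply: (hK k).2.
rewrite -mulr_suml expr2 mulrA ler_wpM2r //.
by rewrite mulrC; have := normr_ge0 (s - t); lra.
Qed.

(** Boundedness has to be assumed: the supremum of an unbounded set is the
    default value [0]. *)
Lemma vnorm_oo_ge (f : R -> 'cV[R[i]]_d) t :
  (exists K, forall s, I11 R s -> euclid_norm (f s) <= K) ->
  I11 R t -> euclid_norm (f t) <= vnorm_oo f.
Proof.
move=> [K hK] It; apply: sup_upper_bound; last by exists t.
by split; [exists (euclid_norm (f t)), t | exists K => _ [s Is <-]; apply: hK].
Qed.

Lemma vnorm_oo_le (f : R -> 'cV[R[i]]_d) K :
  (forall t, I11 R t -> euclid_norm (f t) <= K) -> vnorm_oo f <= K.
Proof.
move=> hK; apply: ge_sup; last by move=> _ [s Is <-]; apply: hK.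
by exists (euclid_norm (f (-1))), (-1) => //; apply/I11P; lra.
Qed.

Lemma mnorm_oo_ge (A : R -> 'M[R[i]]_d) t :
  cont_on A -> I11 R t -> op_norm (A t) <= mnorm_oo A.
Proof.
move=> /cont_on_bounded[K _ hK] It; apply: sup_upper_bound; last by exists t.
split; first by exists (op_norm (A t)), t.
by exists K => _ [s Is <-]; apply: le_trans (op_norm_le_entry _) (hK s Is).
Qed.

End VectorPolynomials.

(** * The defect of the collocation polynomial *)

Section CollocationDefect.
Variables (R : realType) (d N : nat) (A : R -> 'M[R[i]]_d).
Variables (u : R -> 'cV[R[i]]_d) (p : 'cV[{poly R[i]}]_d).
Hypotheses (hN : (1 <= N)%N) (hA : cont_on A) (hu : cont_on u).
Hypothesis hpN : vpoly_degree_le N p.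
Hypothesis hp : forall j : nat, (j <= N - 1)%N ->
  vpoly_eval (vpoly_deriv p) (cheb_node R N j) =
  A (cheb_node R N j) *m vpoly_eval p (cheb_node R N j) + u (cheb_node R N j).

Let Ap t := A t *m vpoly_eval p t.

Definition defect t := vpoly_eval (vpoly_deriv p) t - Ap t - u t.

(** Two polynomials of degree at most [N] that agree at the [N + 1] nodes: both
    vanish at [t_0, ..., t_(N-1)], by collocation and by the choice of [l], and
    both equal the residual at [t_N = -1]. *)
Lemma interp_defect_cardinal :
  exists2 l : {poly R}, forall t, -1 <= t <= 1 -> `|l.[t]| <= 1 &
    forall t, vpoly_eval (vpoly_deriv p - cheb_interp N Ap - cheb_interp N u) t =
      (l.[t])%:C *: defect (-1).
Proof.
have [l [sl l0 l1 lb]] := cheb_boundary_cardinal R hN; exists l => //.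
have [[sAp ApE] _] := cheb_interp_unique_exists Ap hN.
have [[su uE] _] := cheb_interp_unique_exists u hN.
pose D := vpoly_deriv p - cheb_interp N Ap - cheb_interp N u.
pose Q : 'cV[{poly R[i]}]_d := \col_k (defect (-1) k 0 *: map_poly (real_complex R) l).
have QE t : vpoly_eval Q t = (l.[t])%:C *: defect (-1).
  by apply/matrixP => k j; rewrite !mxE hornerZ horner_map mulrC ord1.
have DE j : (j <= N)%N ->
    vpoly_eval D (cheb_node R N j) = defect (cheb_node R N j).
  by move=> jN; rewrite /D !(vpoly_evalD, vpoly_evalN) ApE // uE.
have [_ uniqD] := cheb_interp_unique_exists (vpoly_eval D) hN.
suff DQ : D = Q by move=> t; rewrite -QE -DQ.
have QD : is_cheb_interp N (vpoly_eval D) Q.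
  split=> [k|j].
    by rewrite mxE (leq_trans (size_scale_leq _ _)) // size_map_poly.
  rewrite leq_eqVlt => /orP[/eqP ->|jN].
    by rewrite QE DE // cheb_node_last // l1 scale1r.
  rewrite QE (DE _ (ltnW jN)) l0 // scale0r /defect hp.
    by rewrite /Ap [_ + u _]addrC addrK subrr.
  by rewrite -ltnS subn1 prednK.
have DD : is_cheb_interp N (vpoly_eval D) D.
  split=> // k; rewrite !mxE.
  rewrite (leq_trans (size_polyD _ _)) // size_polyN geq_max su andbT.
  rewrite (leq_trans (size_polyD _ _)) // size_polyN geq_max sAp andbT.
  by rewrite (leq_trans (size_poly _ _)) // (leq_trans (leq_pred _)) // hpN.
by rewrite (uniqD D DD) (uniqD Q QD).
Qed.

Lemma interp_error_bounded (f : R -> 'cV[R[i]]_d) :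
  (exists K, forall t, I11 R t -> euclid_norm (f t) <= K) ->
  exists K, forall t, I11 R t ->
    euclid_norm (f t - vpoly_eval (cheb_interp N f) t) <= K.
Proof.
move=> [K hK]; have [L _ hL] := vpoly_bounded_on (cheb_interp N f).
exists (K + L) => t It; apply: le_trans (euclid_normB _ _) _.
by rewrite lerD ?hK ?hL.
Qed.

Lemma defect_bound t : I11 R t ->
  euclid_norm (defect t) <=
    vnorm_oo (fun t => Ap t - vpoly_eval (cheb_interp N Ap) t)
    + vnorm_oo (fun t => u t - vpoly_eval (cheb_interp N u) t)
    + euclid_norm (defect (-1)).
Proof.
move=> It; have [l lb DE] := interp_defect_cardinal.
have -> : defect t = (l.[t])%:C *: defect (-1)
    - (Ap t - vpoly_eval (cheb_interp N Ap) t)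
    - (u t - vpoly_eval (cheb_interp N u) t).
  rewrite -DE !(vpoly_evalD, vpoly_evalN) /defect.
  by apply/matrixP => i j; rewrite !mxE; ring.
have l_le : euclid_norm ((l.[t])%:C *: defect (-1)) <= euclid_norm (defect (-1)).
  by rewrite euclid_normZr ler_piMl ?euclid_norm_ge0 // lb.
have Ap_le : euclid_norm (Ap t - vpoly_eval (cheb_interp N Ap) t) <=
    vnorm_oo (fun t => Ap t - vpoly_eval (cheb_interp N Ap) t).
  apply: (@vnorm_oo_ge _ _ (fun t => Ap t - _)) => //.
  apply: interp_error_bounded.
  have [K K0 hK] := cont_on_bounded hA; have [L L0 hL] := vpoly_bounded_on p.
  exists (K * L) => s Is; apply: le_trans (euclid_mulmx_entry _ _) _.
  by rewrite ler_pM ?entry_norm_ge0 ?euclid_norm_ge0 ?hK ?hL.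
have u_le : euclid_norm (u t - vpoly_eval (cheb_interp N u) t) <=
    vnorm_oo (fun t => u t - vpoly_eval (cheb_interp N u) t).
  apply: (@vnorm_oo_ge _ _ (fun t => u t - _)) => //.
  apply: interp_error_bounded.
  have [K _ hK] := cont_on_bounded hu; exists K => s Is.
  exact: le_trans (euclid_norm_le_entry _) (hK s Is).
apply: le_trans (euclid_normB _ _) _; rewrite [leRHS]addrAC lerD //.
by apply: le_trans (euclid_normB _ _) _; rewrite addrC lerD.
Qed.

End CollocationDefect.

(** * The error estimates *)

Unset Implicit Arguments.

Theorem theorem18 (R : realType) (d N : nat) (hN : (1 <= N)%N)
    (A Phi : R -> 'M[R[i]]_d) (u y dy : R -> 'cV[R[i]]_d) (y0 : 'cV[R[i]]_d)
    (C_A : R) (p : 'cV[{poly R[i]}]_d)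
    (hA : cont_on A) (hu : cont_on u)
    (hPhi : is_fundamental_solution A Phi)
    (hC : forall s t : R, -1 <= s -> s <= t -> t <= 1 ->
      op_norm (Phi t *m invmx (Phi s)) <= C_A)
    (hy : cont_on y)
    (hdy : forall t : R, I11 R t -> is_derive_on y t (dy t))
    (hode : forall t : R, I11 R t -> dy t = A t *m y t + u t)
    (hy0 : y (-1) = y0)
    (hpN : vpoly_degree_le N p)
    (hp : forall j : nat, (j <= N - 1)%N ->
      vpoly_eval (vpoly_deriv p) (cheb_node R N j) =
      A (cheb_node R N j) *m vpoly_eval p (cheb_node R N j)
        + u (cheb_node R N j))
    (hp0 : vpoly_eval p (-1) = y0) :
  let Ap := fun t : R => A t *m vpoly_eval p t in
  let Rp := vpoly_eval (vpoly_deriv p) (-1) - A (-1) *m y0 - u (-1) in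
  let E := vnorm_oo (fun t => Ap t - vpoly_eval (cheb_interp N Ap) t)
         + vnorm_oo (fun t => u t - vpoly_eval (cheb_interp N u) t)
         + euclid_norm Rp in
  vnorm_oo (fun t => y t - vpoly_eval p t) <= 2 * C_A * E /\
  vnorm_oo (fun t => dy t - vpoly_eval (vpoly_deriv p) t)
    <= (2 * mnorm_oo A * C_A + 1) * E.
Proof.
move=> Ap Rp E.
have unitPhi t : I11 R t -> Phi t \in unitmx.
  exact: fundamental_solution_unit hA hPhi.
have rE t : I11 R t -> euclid_norm (defect A u p t) <= E.
  move=> It; apply: le_trans (defect_bound hN hA hu hpN hp It) _.
  by rewrite /E /Rp /defect hp0.
pose e t := y t - vpoly_eval p t.
have eE t : I11 R t -> euclid_norm (e t) <= 2 * C_A * E.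
  apply: (inhomogeneous_bound hPhi unitPhi hC (r := fun t => - defect A u p t)).
  - move=> c eps Ic eps0; have eps2 : 0 < eps / 2 by lra.
    have [d1 d1_0 h1] := is_derive_on_eps (hdy c Ic) eps2.
    have [d2 d2_0 h2] := vpoly_is_derive p c eps2.
    exists (Num.min d1 d2); first by rewrite lt_min d1_0.
    move=> s Is; rewrite lt_min => /andP[sd1 sd2].
    have {}h1 := le_trans (euclid_norm_le_entry _) (h1 s Is sd1).
    have {}h2 := h2 s Is sd2.
    rewrite (_ : e s - e c - _ = (y s - y c - (s - c)%:C *: dy c) -
      (vpoly_eval p s - vpoly_eval p c
       - (s - c)%:C *: vpoly_eval (vpoly_deriv p) c)).
      by apply: le_trans (euclid_normB _ _) _; lra.
    rewrite hode // /e /defect mulmxBr.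
    by apply/matrixP => i j; rewrite !mxE; ring.
  - by move=> c Ic; rewrite euclid_normN rE.
  - by rewrite /e hy0 hp0 subrr.
split; first exact: vnorm_oo_le.
apply: vnorm_oo_le => t It.
have -> : dy t - vpoly_eval (vpoly_deriv p) t = A t *m e t - defect A u p t.
  by rewrite hode // /e /defect mulmxBr; apply/matrixP => i j; rewrite !mxE; ring.
apply: le_trans (euclid_normB _ _) _.
rewrite mulrDl mul1r lerD ?rE //.
apply: le_trans (euclid_mulmx _ _) _.
rewrite [2 * _]mulrC -!mulrA [2 * _]mulrA ler_pM ?op_norm_ge0 ?euclid_norm_ge0 ?eE //.
exact: mnorm_oo_ge.
Qed.
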